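(* Let $G=(V,E,F)$ be a connected infinite penny graph with bounded facial degree, i.e. $\sup_{\sigma\in F}\deg(\sigma)<\infty$. Then the simple random walk on $G$ is recurrent, and any positive superharmonic function on $G$ is constant.
   Context: Penny graphs: Let $\{B_i\}_{i=1}^\infty$ be a collection of pairwise disjoint open disks of radius $\frac12$ in $\mathbb{R}^2$, with boundary circles $C_i$ and centers $c_i$. Let $V=\{v_i\}_{i=1}^\infty$, and let $\{v_i,v_j\}\in E$ ($i\ne j$) iff $C_i$ and $C_j$ are tangent, i.e. $|c_i-c_j|=1$. The embedding $\phi$ is given by $\phi(v_i)=c_i$, $\phi(\{v_i,v_j\})=\overline{c_ic_j}$ (the straight segment). The set $F$ of faces corresponds to the connected components of the complement in $\mathbb{R}^2$ of the embedded image of $(V,E)$; for $\sigma\in F$, $\phi(\sigma)$ denotes the corresponding component. The facial degree $\deg(\sigma)\in\mathbb{N}\cup\{\infty\}$ is the number of interior angles (corners at embedded vertices, counted with multiplicity) of the polygonal domain $\phi(\sigma)$. The triple $G=(V,E,F)$ is called an infinite penny graph; it is connected if the graph $(V,E)$ is connected. The simple random walk on $G$ is the Markov chain on $V$ moving from $x$ to each neighbor with probability $1/\deg(x)$, where $\deg(x)$ is the number of neighbors of $x$ in $(V,E)$. The Laplacian is $\Delta f(x)=\sum_{y\sim x}(f(y)-f(x))$ for $f:V\to\mathbb{R}$, $x\in V$, the sum being over neighbors $y$ of $x$; $f$ is superharmonic if $\Delta f\le0$ on $V$. *)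

(* Defs.v *)
From HB Require Import structures.
From mathcomp Require Import all_boot all_order all_algebra finmap.
From mathcomp Require Import all_classical all_reals all_analysis.
Import Order.TTheory GRing.Theory Num.Theory.
Import numFieldNormedType.Exports.

Set Implicit Arguments.
Unset Strict Implicit.
Unset Printing Implicit Defensive.

Local Open Scope classical_set_scope.
Local Open Scope ring_scope.

(* The library norm on 'rV[R]_2 is the sup norm; its topology is the usual one
   of the plane, but distances have to be Euclidean. *)
Definition edist (R : realType) (p q : 'rV[R]_2) : R :=
  Num.sqrt (\sum_(k < 2) (p 0 k - q 0 k) ^+ 2).

Definition edisk (R : realType) (p : 'rV[R]_2) (r : R) : set 'rV[R]_2 :=
  [set q | edist p q < r].

Definition segment (R : realType) (p q : 'rV[R]_2) : set 'rV[R]_2 :=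
  [set (1 - t) *: p + t *: q | t in `[0, 1]].

(* The vertex v_i is represented by its index i. *)
Record penny_graph (R : realType) := PennyGraph {
  center : nat -> 'rV[R]_2;
  penny_disjoint : forall i j : nat, i != j ->
    edisk (center i) (2^-1) `&` edisk (center j) (2^-1) = set0
}.

Section PennyGraphs.
Variables (R : realType) (G : penny_graph R).

Definition penny (i : nat) : set 'rV[R]_2 := edisk (center G i) (2^-1).

Definition adj : rel nat :=
  fun i j => (i != j) && (edist (center G i) (center G j) == 1).

Definition graph_connected : Prop :=
  forall i j : nat, exists2 p : seq nat, path adj i p & last i p = j.

Definition embedded_image : set 'rV[R]_2 :=
  range (center G) `|`
  [set p | exists i j, adj i j /\ segment (center G i) (center G j) p].

Definition face : set (set 'rV[R]_2) :=
  [set connected_component (~` embedded_image) p | p in ~` embedded_image].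

(* A corner of the face s is a pair (i, S) where S is a sector of s at v_i.
   An edge not incident to v_i stays at distance at least sqrt 3 / 2 from c_i,
   so inside the open penny B_i the embedded image consists of the radii along
   the edges at v_i; they cut B_i into deg v_i sectors when deg v_i > 0.  A face
   meeting B_i in several sectors has as many corners at v_i. *)
Definition corner (s : set 'rV[R]_2) : set (nat * set 'rV[R]_2) :=
  [set iS | iS.2 `<=` s /\
     exists2 p, (penny iS.1 `\` embedded_image) p &
       iS.2 = connected_component (penny iS.1 `\` embedded_image) p].

Definition facial_degree (s : set 'rV[R]_2) : \bar R := counting (corner s).

Definition bounded_facial_degree : Prop :=
  (ereal_sup [set facial_degree s | s in face] < +oo)%E.

(* By disjointness of the pennies a vertex has at most six neighbors, so the
   finite cardinal and the finitely supported sum below have their usual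
   meaning. *)
Definition neighbors (i : nat) : set nat := [set j | adj i j].

Definition deg (i : nat) : nat := #|` fset_set (neighbors i)|.

Definition laplacian (f : nat -> R) (x : nat) : R :=
  \sum_(y \in neighbors x) (f y - f x).

Definition superharmonic (f : nat -> R) : Prop :=
  forall x, laplacian f x <= 0.

Definition srw_step (x y : nat) : R :=
  if adj x y then (deg x)%:R^-1 else 0.

Definition history d (T : measurableType d) (P : probability T R)
    (X : nat -> {RV P >-> nat}) (s : nat -> nat) (n : nat) : set T :=
  [set w | forall k, (k <= n)%N -> X k w = s k].

(* Markov property in multiplied-out form: no conditioning on null events. *)
Definition simple_random_walk d (T : measurableType d) (P : probability T R)
    (X : nat -> {RV P >-> nat}) (x : nat) : Prop :=
  P [set w | X 0%N w = x] = 1%E /\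
  forall (n : nat) (s : nat -> nat),
    P (history X s n.+1) = (P (history X s n) * (srw_step (s n) (s n.+1))%:E)%E.

Definition srw_recurrent : Prop :=
  forall (d : measure_display) (T : measurableType d) (P : probability T R)
    (X : nat -> {RV P >-> nat}) (x : nat),
    simple_random_walk X x ->
    P [set w | exists2 n, (0 < n)%N & X n w = x] = 1%E.

End PennyGraphs.

(* Main.v *)
(* Squares of side 1/2 contain at most one center each, so the graph embeds
   injectively in Z^2 with edges of length at most 2.  Quadratic volume growth
   makes the Dirichlet energy of logarithmic cutoff functions phi arbitrarily
   small.  Testing a positive superharmonic u against phi^2 / u (Picone's
   identity) bounds (u x - u y)^2 / (u x * u y) on each edge by that energy, so u
   is constant.  For recurrence, the function g that is 0 at x and elsewhere the
   probability of never visiting x is subharmonic, so 2 - g is constant and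
   g = 0. *)
Require Import Defs.
From HB Require Import structures.
From mathcomp Require Import all_boot all_order all_algebra.
From mathcomp Require Import finmap zify lra ring.
From mathcomp Require Import all_classical all_reals all_analysis.
Import Order.TTheory GRing.Theory Num.Theory.
Import numFieldNormedType.Exports.
(* mathcomp-analysis has another [edist]. *)
Import Defs.

Set Implicit Arguments.
Unset Strict Implicit.
Unset Printing Implicit Defensive.

Local Open Scope ring_scope.

(** * Distances between centers and their cells in the half-integer grid *)

Lemma edist_sqr (R : realType) (p q : 'rV[R]_2) :
  edist p q ^+ 2 = (p 0 0 - q 0 0) ^+ 2 + (p 0 1 - q 0 1) ^+ 2.
Proof.
rewrite /edist sqr_sqrtr ?sumr_ge0// => [|k _]; last exact: sqr_ge0.
rewrite big_ord_recl big_ord1; congr (_ + (p _ _ - q _ _) ^+ 2);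
  exact: val_inj.
Qed.

Lemma edist_ge0 (R : realType) (p q : 'rV[R]_2) : 0 <= edist p q.
Proof. exact: sqrtr_ge0. Qed.

(** Otherwise the midpoint, at half the distance from either center, would lie in both disks. *)
Lemma center_dist_ge1 (R : realType) (G : penny_graph R) (i j : nat) :
  i != j -> 1 <= edist (center G i) (center G j).
Proof.
move=> ij; rewrite leNgt; apply/negP => dlt1.
have /seteqP[+ _] := penny_disjoint G ij.
move=> /(_ (2^-1 *: (center G i + center G j))); apply.
have half_lt (p q : 'rV[R]_2) : edist p q ^+ 2 = 4^-1 * edist (center G i) (center G j) ^+ 2 ->
    edist p q < 2^-1.
  have := edist_ge0 p q; have := edist_ge0 (center G i) (center G j); nra.
by split; apply: half_lt; rewrite !edist_sqr !mxE; field.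
Qed.

Lemma adj_sym (R : realType) (G : penny_graph R) : symmetric (adj G).
Proof.
move=> i j; rewrite /adj eq_sym; congr (_ && (_ == 1)).
by congr Num.sqrt; apply: eq_bigr => k _; rewrite -sqrrN opprB.
Qed.

Definition cell (R : realType) (G : penny_graph R) (i : nat) : int * int :=
  (Num.floor (2 * center G i 0 0), Num.floor (2 * center G i 0 1)).

Lemma floor_eq_dist (R : realType) (x y : R) :
  Num.floor x = Num.floor y -> `|x - y| < 1.
Proof.
move=> xy; have := floor_itv x; have := floor_itv y; rewrite xy => /andP[] + + /andP[].
rewrite intrD ltr_norml; lra.
Qed.

(* Cells have side 1/2, hence diameter smaller than 1. *)
Lemma cell_inj (R : realType) (G : penny_graph R) : injective (cell G).
Proof.
move=> i j [/floor_eq_dist + /floor_eq_dist]; rewrite !ltr_norml => /andP[a b] /andP[c d].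
apply/eqP; apply: contraT => /(center_dist_ge1 G) d1.
have := edist_sqr (center G i) (center G j); nra.
Qed.

(** The floors differ by less than 3 as reals, hence by at most 2 as integers. *)
Lemma floor_dist (R : realType) (x y : R) :
  `|x - y| <= 2 -> (`|Num.floor x - Num.floor y|%N <= 2)%N.
Proof.
have := floor_itv x; have := floor_itv y; rewrite ler_norml => /andP[] + + /andP[].
set a := Num.floor x; set b := Num.floor y; rewrite !intrD => h1 h2 h3 h4 /andP[h5 h6].
have : (a - b)%:~R < 3%:~R :> R by rewrite intrD intrN; lra.
have : (b - a)%:~R < 3%:~R :> R by rewrite intrD intrN; lra.
rewrite !ltr_int; lia.
Qed.

Lemma adj_cell (R : realType) (G : penny_graph R) (i j : nat) : adj G i j ->
  (`|(cell G i).1 - (cell G j).1|%N <= 2)%N /\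
  (`|(cell G i).2 - (cell G j).2|%N <= 2)%N.
Proof.
move=> /andP[_ /eqP d1]; have := edist_sqr (center G i) (center G j).
set dx := _ - _; set dy := _ - _; rewrite d1 => h.
have := sqr_ge0 dx; have := sqr_ge0 dy => dy0 dx0.
by split; apply: floor_dist; rewrite -mulrBr ler_norml -/dx -/dy; apply/andP; split; nra.
Qed.

(** * Counting vertices in squares of the grid *)

Lemma ler_sum_inj (R : numDomainType) (I J : finType) (A : {pred I}) (h : I -> J)
    (F : J -> R) : {in A &, injective h} -> (forall j, 0 <= F j) ->
  \sum_(i in A) F (h i) <= \sum_j F j.
Proof.
move=> hI F0; rewrite -(big_imset F hI) [leRHS](bigID [in [set h x | x in A]])/=.
by rewrite lerDl sumr_ge0.
Qed.

(** Enlarging the square from side [N] to [N + 1] adds a border of [N + N + 1] pairs, on all of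
    which the maximum is [N]. *)
Lemma sum_maxn_square (R : comNzRingType) (g : nat -> R) (N : nat) :
  \sum_(i < N) \sum_(j < N) g (maxn i j) = \sum_(n < N) g n *+ n.*2.+1.
Proof.
elim: N => [|N IH]; first by rewrite !big_ord0.
rewrite big_ord_recr/= [in RHS]big_ord_recr/= -IH.
under eq_bigr do rewrite big_ord_recr/= (maxn_idPr (ltnW (ltn_ord _))).
rewrite big_split/= -addrA; congr (_ + _).
rewrite big_ord_recr/= maxnn.
under [X in _ + (X + _)]eq_bigr => i _ do rewrite (maxn_idPl (ltnW (ltn_ord i))).
rewrite !sumr_const card_ord -addnn mulrSr mulrnDr; ring.
Qed.

(** The sup norm on the grid, which replaces the distance to the origin in the cutoff. *)
Definition level (cell : nat -> int * int) (v : nat) : nat :=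
  maxn `|(cell v).1| `|(cell v).2|.

(** Signs and absolute values send the cells of level at most [K] injectively into a finite type,
    made of four copies of a grid of side [K + 1]. *)
Definition cell_code (K : nat) (c : int * int) : bool * bool * ('I_K.+1 * 'I_K.+1) :=
  ((0 <= c.1, 0 <= c.2), (inord `|c.1|, inord `|c.2|)).

Lemma cell_code_inj (K : nat) (cell : nat -> int * int) : injective cell ->
  {in [pred v | level cell v <= K]%N &, injective (fun v => cell_code K (cell v))}.
Proof.
move=> cI v w; rewrite !inE !geq_max => /andP[v1 v2] /andP[w1 w2].
case=> s1 s2 /(congr1 val) + /(congr1 val); rewrite /= !inordK ?ltnS// => a1 a2.
apply: cI; move: s1 s2 a1 a2; case: (cell v) (cell w) => [a b] [c d] /=.
by case: a c b d => a [] c [] b [] d//=; rewrite ?NegzE => *; congr pair; lia.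
Qed.

(** Each of the four sign patterns contributes at most one full quadrant, which [sum_maxn_square]
    regroups by shells. *)
Lemma sum_level_le (R : realType) (cell : nat -> int * int) (g : nat -> R)
    (K M : nat) : injective cell -> (forall n, 0 <= g n) ->
  \sum_(v < M | (level cell v <= K)%N) g (level cell v) <=
  4 * \sum_(n < K.+1) g n *+ n.*2.+1.
Proof.
move=> cI g0.
pose F (c : bool * bool * ('I_K.+1 * 'I_K.+1)) := g (maxn c.2.1 c.2.2).
rewrite (eq_bigr (fun v : 'I_M => F (cell_code K (cell v)))) => [|v]; last first.
  by rewrite /F /level geq_max /= => /andP[? ?]; rewrite !inordK.
have hI : {in [pred v : 'I_M | (level cell v <= K)%N] &,
    injective (fun v : 'I_M => cell_code K (cell v))}.
  by move=> v w vK wK /(cell_code_inj cI vK wK) /val_inj.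
apply: le_trans (ler_sum_inj (F := F) hI _) _; first by move=> j; exact: g0.
rewrite -sum_maxn_square -(pair_bigA _ (fun _ (d : 'I_K.+1 * 'I_K.+1) => g (maxn d.1 d.2)))/=.
rewrite sumr_const card_prod card_bool mulr_natl.
rewrite -(pair_bigA _ (fun i j : 'I_K.+1 => g (maxn i j)))/=.
by [].
Qed.

Lemma level_bounded (cell : nat -> int * int) (K : nat) : injective cell ->
  exists M, forall v, (level cell v <= K)%N -> (v < M)%N.
Proof.
move=> cI.
have : finite_set [set v | (level cell v <= K)%N].
  rewrite -(eq_finite_set (@inj_card_eq _ _ _ (fun v => cell_code K (cell v)) _)).
    exact: finite_finset.
  move=> v w; rewrite !inE/= => vK wK; exact: cell_code_inj.
move=> /finite_seqP[s sE]; exists (\max_(v <- s) v).+1 => v vK.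
have : v \in s by have : [set` s]%classic v by rewrite -sE.
by move=> /leq_bigmax_seq; rewrite ltnS; apply.
Qed.

(** * Harmonic sums and the logarithmic cutoff *)

Definition hsum (R : realType) (L n : nat) : R :=
  \sum_(L <= j < n) j.+3%:R^-1.

Lemma hsum_le (R : realType) (L : nat) : {homo @hsum R L : m n / (m <= n)%N >-> m <= n}.
Proof.
move=> m n mn; rewrite /hsum; have [Lm|mL] := leqP L m.
  by rewrite (big_cat_nat _ mn)//= lerDl sumr_ge0.
by rewrite (big_geq (ltnW mL)) sumr_ge0.
Qed.

Lemma hsum_eq0 (R : realType) (L n : nat) : (n <= L)%N -> hsum R L n = 0.
Proof. exact: big_geq. Qed.

Lemma hsum_succ (R : realType) (L n : nat) : hsum R L n.+1 <= hsum R L n + n.+3%:R^-1.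
Proof.
have [Ln|nL] := leqP L n; first by rewrite /hsum big_nat_recr.
by rewrite hsum_eq0// addr_ge0 ?invr_ge0// sumr_ge0.
Qed.

Lemma hsum_add2 (R : realType) (L m n : nat) : (m <= n.+2)%N ->
  hsum R L m - hsum R L n <= 2 / n.+3%:R.
Proof.
move=> /(@hsum_le R L) mn.
have := hsum_succ R L n; have := hsum_succ R L n.+1.
have : n.+4%:R^-1 <= n.+3%:R^-1 :> R by rewrite lef_pV2 ?posrE// ler_nat.
move: (n.+3%:R^-1) (n.+4%:R^-1) => a b; lra.
Qed.

(** At most two terms separate the sums, and their indices are at least [n - 2]; the shift by 3 in
    [hsum] turns this into denominators of at least [n + 1], whichever of [m] and [n] is larger. *)
Lemma hsum_dist (R : realType) (L m n : nat) : (m <= n.+2)%N -> (n <= m.+2)%N ->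
  `|hsum R L m - hsum R L n| <= 2 / n.+1%:R.
Proof.
move=> mn nm; rewrite ler_norml; apply/andP; split.
  rewrite lerNl opprB; apply: le_trans (hsum_add2 R L nm) _.
  by rewrite ler_pM2l// lef_pV2 ?posrE// ler_nat.
apply: le_trans (hsum_add2 R L mn) _.
by rewrite ler_pM2l// lef_pV2 ?posrE// ler_nat; lia.
Qed.

Lemma sum_harmonic_le (R : realType) (n : nat) :
  \sum_(0 <= i < n) i.+1%:R^-1 <= n%:R :> R.
Proof.
rewrite -[n in leRHS]subn0 -sumr_const_nat ler_sum// => i _.
by rewrite invf_le1// ler1n.
Qed.

(** Up to the first [L + 2] terms, each at most 1, this is a partial sum of the divergent harmonic
    series. *)
Lemma hsum_unbounded (R : realType) (L : nat) (A : R) : exists N, A <= hsum R L N.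
Proof.
have := nondecreasing_dvgn_lt (@nondecreasing_series _ _ predT 0 _) (@dvg_harmonic R).
move=> /(_ (fun n _ _ => harmonic_ge0 n)) /cvgryPge /(_ (A + L.+2%:R)) [N _ /(_ (L.+2 + N)%N)].
rewrite /= leq_addl => /(_ isT) h; exists (L + N)%N; move: h.
rewrite /series/= (@big_cat_nat _ _ _ L.+2)//= ?leq_addr//.
have -> : \sum_(L.+2 <= i < (L.+2 + N)) harmonic i = hsum R L (L + N).
  rewrite -(addn2 L) (addnAC L) big_addn addnK.
  by apply: eq_bigr => i _; rewrite addn2.
have : \sum_(0 <= i < L.+2) harmonic i <= L.+2%:R :> R.
  exact: sum_harmonic_le.
lra.
Qed.

(* A neighbor of [v] lies in the 5 x 5 block of cells around that of [v]. *)
Lemma sum_nbr_le25 (R : realType) (e : rel nat) (cell : nat -> int * int) (v M : nat)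
    (c : R) : injective cell ->
  (forall v w, e v w -> (`|(cell v).1 - (cell w).1|%N <= 2)%N /\
    (`|(cell v).2 - (cell w).2|%N <= 2)%N) ->
  0 <= c -> \sum_(w < M | e v w) c <= 25 * c.
Proof.
move=> cI lip c0.
pose h (w : 'I_M) : 'I_5 * 'I_5 :=
  (inord (absz ((cell w).1 - (cell v).1 + 2)), inord (absz ((cell w).2 - (cell v).2 + 2))).
have hI : {in [pred w : 'I_M | e v w] &, injective h}.
  move=> w1 w2; rewrite !inE => /lip[p1 q1] /lip[p2 q2].
  case=> /(congr1 val) + /(congr1 val); rewrite /= !inordK; try lia.
  move=> a b; apply/val_inj/cI; move: a b p1 q1 p2 q2.
  by case: (cell w1) (cell w2) (cell v) => [? ?] [? ?] [? ?]/= *; congr pair; lia.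
apply: le_trans (ler_sum_inj (F := fun=> c) hI _) _ => //.
by rewrite sumr_const card_prod !card_ord mulr_natl.
Qed.

(** The cutoff falls from 1 to 0 linearly in [hsum] of the level, whose total is [S]. An edge at
    level [n] costs O(1/(S n)^2) and O(n) vertices lie there, so the energy is a harmonic sum
    divided by [S ^+ 2], of order 1/S. *)
Lemma log_cutoff (R : realType) (e : rel nat) (cell : nat -> int * int) (L : nat)
    (eps : R) : injective cell ->
  (forall v w, e v w -> (`|(cell v).1 - (cell w).1|%N <= 2)%N /\
    (`|(cell v).2 - (cell w).2|%N <= 2)%N) ->
  0 < eps ->
  exists M (phi : nat -> R),
    [/\ forall v w, phi v != 0 -> e v w -> (v < M)%N && (w < M)%N,
        forall v, (level cell v <= L)%N -> phi v = 1 &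
        \sum_(v < M) \sum_(w < M | e v w) (phi v - phi w) ^+ 2 <= eps].
Proof.
move=> cI lip eps0.
(* The bound [L + 2] absorbs the low harmonic terms. In 1600 = 25 * 4 * 16, the factors are the
   neighbor count, the square of the 2 in [hsum_dist], and the constant of [E1 <= 16 * S]. *)
have [N hN] := hsum_unbounded L (Num.max L.+2%:R (1600 / eps)).
set S := hsum R L N in hN.
move: hN; rewrite ge_max => /andP[SL Seps].
have S0 : 0 < S by apply: lt_le_trans SL.
pose psi n := Num.max 0 (1 - hsum R L n / S).
have LN : (L < N)%N.
  by rewrite ltnNge; apply/negP => /(hsum_eq0 R) SE; move: S0; rewrite /S SE ltxx.
have psi0 n : (N <= n)%N -> psi n = 0.
  move=> /(@hsum_le R L) Sn; apply/max_idPl.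
  by rewrite subr_le0 ler_pdivlMr// mul1r.
have psi_dist m n : (m <= n.+2)%N -> (n <= m.+2)%N ->
    (psi m - psi n) ^+ 2 <= 4 / S ^+ 2 * n.+1%:R^-2.
  move=> mn nm; have := hsum_dist R L mn nm.
  set a := hsum R L m; set b := hsum R L n => ab.
  have : `|psi m - psi n| <= 2 / n.+1%:R / S.
    have : `|a / S - b / S| <= 2 / n.+1%:R / S.
      by rewrite -mulrBl normrM (gtr0_norm (_ : 0 < S^-1)) ?invr_gt0// ler_pM2r ?invr_gt0.
    rewrite /psi -/a -/b; move: (a / S) (b / S) (2 / _ / _) => x y z.
    rewrite !ler_norml /Num.max => /andP[? ?].
    by case: ltP => ?; case: ltP => ?; apply/andP; split; lra.
  have z0 : 0 <= 2 / n.+1%:R / S by rewrite !divr_ge0// ltW.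
  move=> le_psi; rewrite -real_normK ?num_real//.
  apply: le_trans (lerXn2r 2 _ _ le_psi) _; rewrite ?nnegrE//.
  rewrite le_eqVlt; apply/orP; left; apply/eqP; field.
  by apply/andP; split; apply: lt0r_neq0; have := ler0n R n; lra.
have lvl v w : e v w ->
    (level cell v <= (level cell w).+2)%N /\ (level cell w <= (level cell v).+2)%N.
  by move=> /lip; rewrite /level; case: (cell v) (cell w) => [? ?] [? ?]/=; lia.
(* [psi] vanishes from level [N] on and an edge changes the level by at most 2, so every edge that
   touches the support stays within level [N + 1]. *)
have [M hM] := level_bounded N.+1 cI.
exists M, (fun v => psi (level cell v)); split.
- move=> v w nz /lvl[vw wv]; have vN : (level cell v < N)%N.
    by rewrite ltnNge; apply: contra nz => /psi0 ->.
  by rewrite !hM//; lia.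
- move=> v vL; rewrite /psi hsum_eq0// mul0r subr0; apply/max_idPr; exact: ler01.
have step (v : 'I_M) : \sum_(w < M | e v w) (psi (level cell v) - psi (level cell w)) ^+ 2 <=
    if (level cell v <= N.+1)%N then 25 * (4 / S ^+ 2 * (level cell v).+1%:R^-2) else 0.
  case: ifP => vN.
    apply: le_trans (sum_nbr_le25 v M cI lip _); last first.
      by rewrite mulr_ge0 ?divr_ge0 ?invr_ge0 ?sqr_ge0.
    apply: ler_sum => w /lvl[vw wv]; rewrite -sqrrN opprB; exact: psi_dist.
  rewrite big1// => w /lvl[vw wv]; rewrite !psi0 ?subr0 ?expr0n//; lia.
apply: le_trans (ler_sum _ (fun v _ => step v)) _.
rewrite -big_mkcond/= -!mulr_sumr.
have := @sum_level_le R cell (fun n => n.+1%:R^-2) N.+1 M cI.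
move=> /(_ (fun n => _)) /=.
set E1 := \sum_(i < M | _) _; set E2 := \sum_(i < _) _ => E12.
have {}E12 : E1 <= 4 * E2 by apply: E12 => n; rewrite invr_ge0 sqr_ge0.
(* Shell [n] has weight (2n+1)/(n+1)^2, at most 2/(n+1). *)
have : E2 <= 2 * \sum_(0 <= n < N.+2) n.+1%:R^-1.
  rewrite big_mkord mulr_sumr; apply: ler_sum => n _.
  have : n.*2.+1%:R <= 2 * n.+1%:R :> R by rewrite -natrM ler_nat; lia.
  have : n.+1%:R^-1 * n.+1%:R = 1 :> R by rewrite mulVf ?pnatr_eq0.
  have : 0 < n.+1%:R^-1 :> R by rewrite invr_gt0.
  rewrite -(mulr_natr (_ ^- 2)) expr2 invfM.
  move: n.+1%:R n.+1%:R^-1 n.*2.+1%:R => x y k y0 yx kx.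
  have yk : y * k <= 2 by nra.
  by rewrite -mulrA mulrC ler_pM2r.
(* From index [L + 2] on, the terms add up to exactly [S]. *)
have : \sum_(0 <= n < N.+2) n.+1%:R^-1 <= L.+2%:R + S.
  rewrite (@big_cat_nat _ _ _ L.+2)//= ?ltnS 1?ltnW//; apply: lerD.
    exact: sum_harmonic_le.
  rewrite -(addn2 L) -(addn2 N) big_addn addnK le_eqVlt; apply/orP; left; apply/eqP.
  by apply: eq_bigr => n _; rewrite addn2.
move=> H1 H2; have E16 : E1 <= 16 * S by lra.
have -> : eps = 25 * (4 / S ^+ 2 * (eps * S ^+ 2 / 100)) by field; lra.
rewrite ler_pM2l// ler_pM2l ?divr_gt0 ?exprn_gt0//.
apply: le_trans E16 _; move: Seps; rewrite ler_pdivrMr//; nra.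
Qed.

(** * The Liouville property for positive superharmonic functions *)

Lemma adj_level (R : realType) (G : penny_graph R) (v w : nat) :
  adj G v w -> (level (cell G) w <= (level (cell G) v).+2)%N.
Proof.
by move=> /adj_cell; rewrite /level; case: (cell G v) (cell G w) => [? ?] [? ?]/=; lia.
Qed.

Lemma neighbors_bounded (R : realType) (G : penny_graph R) (v : nat) :
  exists M, forall w, adj G v w -> (w < M)%N.
Proof.
have [M hM] := level_bounded (level (cell G) v).+2 (@cell_inj R G).
by exists M => w /adj_level/hM.
Qed.

Lemma finite_neighbors (R : realType) (G : penny_graph R) (v : nat) :
  finite_set (neighbors G v).
Proof.
have [M hM] := neighbors_bounded G v.
by apply: (sub_finite_set _ (finite_II M)) => w /hM.
Qed.

Lemma sum_neighbors (R : realType) (G : penny_graph R) (F : nat -> R) (v M : nat) :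
  (forall w, adj G v w -> (w < M)%N) ->
  \sum_(w \in neighbors G v) F w = \sum_(w < M | adj G v w) F w.
Proof.
move=> hM; rewrite fsbig_finite; last exact: finite_neighbors.
rewrite -(big_mkord (adj G v) F) -[RHS]big_filter; apply: perm_big.
apply: uniq_perm; rewrite ?fset_uniq ?filter_uniq ?iota_uniq// => w.
rewrite in_fset_set; last exact: finite_neighbors.
rewrite mem_filter mem_index_iota /=; apply/idP/idP => [|/andP[vw _]]; last by rewrite inE.
by rewrite inE => /[dup] vw /hM ->; rewrite andbT.
Qed.

Lemma adj_superharmonic_eq (R : realType) (G : penny_graph R) (u : nat -> R) (x y : nat) :
  (forall v, 0 < u v) -> superharmonic G u -> adj G x y -> u x = u y.
Proof.
move=> u0 uS xy.
suff small eps : 0 < eps -> (u y - u x) ^+ 2 / (u x * u y) <= eps.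
  have uxy := mulr_gt0 (u0 x) (u0 y).
  apply/esym/eqP; rewrite -subr_eq0 -sqrf_eq0; apply: contraT => nz.
  have pos : 0 < (u y - u x) ^+ 2 / (u x * u y).
    by rewrite divr_gt0// lt0r nz sqr_ge0.
  have := small (((u y - u x) ^+ 2 / (u x * u y)) / 2) (divr_gt0 pos (ltr0Sn R 1)); lra.
move=> eps0.
(* The plateau of the cutoff contains both [x] and [y], so that [D x y] below is the quantity to
   bound. *)
have [M [phi [supp phi1 energy]]] := log_cutoff (maxn (level (cell G) x) (level (cell G) y))
  (@cell_inj R G) (@adj_cell R G) eps0.
have px : phi x = 1 by rewrite phi1// leq_maxl.
have py : phi y = 1 by rewrite phi1// leq_maxr.
have /andP[xM yM] : (x < M)%N && (y < M)%N by apply: supp xy; rewrite px oner_eq0.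
(* Over the neighbors [w] of [v], these terms sum to [- (phi v ^+ 2 / u v)] times the Laplacian of
   [u] at [v]. *)
pose t v w := phi v ^+ 2 * (1 - u w / u v).
(* This is [u v * u w * (phi v / u v - phi w / u w) ^+ 2], the nonnegative remainder in Picone's
   identity. *)
pose D v w := (phi v * u w - phi w * u v) ^+ 2 / (u v * u w).
have D0 v w : 0 <= D v w by rewrite divr_ge0 ?sqr_ge0// mulr_ge0// ltW.
have picone v w : D v w = (phi v - phi w) ^+ 2 - t v w - t w v.
  by rewrite /D /t; field; rewrite !gt_eqF.
pose T := \sum_(v < M) \sum_(w < M | adj G v w) t v w.
(* Where [phi v] is nonzero, all neighbors of [v] are below [M], so the inner sum is the complete
   Laplacian. *)
have T0 : 0 <= T.
  apply: sumr_ge0 => v _; have [p0|p0] := eqVneq (phi v) 0.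
    by rewrite big1// => w _; rewrite /t p0 expr0n mul0r.
  have hM w : adj G v w -> (w < M)%N by move=> /(supp _ _ p0)/andP[].
  rewrite (eq_bigr (fun w : 'I_M => - (phi v ^+ 2 / u v) * (u w - u v))).
    rewrite -mulr_sumr mulNr oppr_ge0 pmulr_rle0; last first.
      by rewrite divr_gt0// lt0r sqr_ge0 sqrf_eq0 p0.
    by have := uS v; rewrite /laplacian (sum_neighbors _ hM).
  by move=> w _; rewrite /t; field; rewrite gt_eqF.
have TE : \sum_(v < M) \sum_(w < M | adj G v w) t w v = T.
  rewrite /T (eq_bigr _ (fun v _ => big_mkcond _ _)) exchange_big/=.
  by apply: eq_bigr => v _; rewrite [RHS]big_mkcond; apply: eq_bigr => w _; rewrite adj_sym.
(* By symmetry of adjacency both kinds of [t] terms sum to [T], so the total of [D] is the energy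
   minus twice [T]. *)
have DE : \sum_(v < M) \sum_(w < M | adj G v w) D v w <= eps.
  under eq_bigr => v _ do (under eq_bigr => w _ do rewrite picone; rewrite !sumrB).
  rewrite !sumrB TE -/T; lra.
have -> : (u y - u x) ^+ 2 / (u x * u y) = D x y by rewrite /D px py !mul1r.
apply: le_trans DE.
rewrite (bigD1 (Ordinal xM))//= (bigD1 (Ordinal yM))//= -addrA lerDl addr_ge0//.
  by apply: sumr_ge0.
by do 2 apply: sumr_ge0 => ? _.
Qed.

Lemma positive_superharmonic_const (R : realType) (G : penny_graph R) (u : nat -> R) :
  graph_connected G -> (forall v, 0 < u v) -> superharmonic G u ->
  forall x y, u x = u y.
Proof.
move=> Gconn u0 uS x y; have [p + <-] := Gconn x y.
elim: p x => //= z p IH x /andP[xz /IH <-].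
exact: adj_superharmonic_eq uS xz.
Qed.

(** * Avoidance probabilities and their limit *)

Lemma has_neighbor (R : realType) (G : penny_graph R) (x : nat) :
  graph_connected G -> exists y, adj G x y.
Proof.
move=> /(_ x x.+1) [[_|y p /andP[xy _] _]]; last by exists y.
by move=> /= /n_Sn.
Qed.

Lemma deg_gt0 (R : realType) (G : penny_graph R) (x : nat) :
  graph_connected G -> (0 < deg G x)%N.
Proof.
move=> /(@has_neighbor _ _ x) [y xy]; rewrite cardfs_gt0; apply/fset0Pn; exists y.
by rewrite in_fset_set ?inE//; exact: finite_neighbors.
Qed.

Lemma sum_neighbors_const (R : realType) (G : penny_graph R) (c : R) (v : nat) :
  \sum_(w \in neighbors G v) c = (deg G v)%:R * c.
Proof.
rewrite fsbig_finite; last exact: finite_neighbors.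
by rewrite big_const_seq count_predT iter_addr_0 mulr_natl.
Qed.

(* The probability that the walk started at [y] avoids [x] at the times 1, ..., n. *)
Fixpoint avoid (R : realType) (G : penny_graph R) (x n y : nat) : R :=
  if n is m.+1 then
    (deg G y)%:R^-1 * \sum_(z \in neighbors G y) (z != x)%:R * avoid G x m z
  else 1.

Lemma avoid_itv (R : realType) (G : penny_graph R) (x n y : nat) :
  graph_connected G -> 0 <= avoid G x n y <= 1.
Proof.
move=> Gconn; elim: n y => [|n IH] y /=; first by rewrite ler01 lexx.
have [M hM] := neighbors_bounded G y.
have d0 : 0 < (deg G y)%:R :> R by rewrite ltr0n deg_gt0.
have I z : 0 <= (z != x)%:R * avoid G x n z <= 1.
  by case: (z != x); rewrite ?mul1r// mul0r lexx ler01.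
rewrite (sum_neighbors _ hM); apply/andP; split.
  by rewrite mulr_ge0 ?invr_ge0 ?ler0n// sumr_ge0// => z _; case/andP: (I z).
rewrite ler_pdivrMl// -(sum_neighbors_const G 1) (sum_neighbors _ hM).
by apply: ler_sum => z _; case/andP: (I z).
Qed.

Lemma avoid_le (R : realType) (G : penny_graph R) (x y : nat) :
  graph_connected G -> {homo (fun n => avoid G x n y) : m n / (m <= n)%N >-> n <= m}.
Proof.
move=> Gconn; apply: (homo_leq (r := fun a b : R => b <= a)) => [//|a b c ba cb|n].
  exact: le_trans cb ba.
elim: n y => [|n IH] y; first by case/andP: (avoid_itv x 1 y Gconn).
have [M hM] := neighbors_bounded G y.
rewrite [leLHS]/= [leRHS]/= !(sum_neighbors _ hM) ler_wpM2l ?invr_ge0 ?ler0n//.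
apply: ler_sum => z _; rewrite ler_wpM2l ?ler0n//; exact: IH.
Qed.

Lemma avoid_cvg0 (R : realType) (G : penny_graph R) (x : nat) :
  graph_connected G -> (avoid G x ^~ x @ \oo --> (0 : R))%classic.
Proof.
move=> Gconn.
(* The probability, starting from [y], of never visiting [x] at a positive time. *)
pose Q y := limn (avoid G x ^~ y).
have Qcvg y : (avoid G x ^~ y @ \oo --> Q y)%classic.
  apply: nonincreasing_is_cvgn; first exact: avoid_le.
  by exists 0 => _ [n _ <-]; case/andP: (avoid_itv x n y Gconn).
have Q0 y : 0 <= Q y.
  by apply: limr_ge; [exact: Qcvg|near=> n; case/andP: (avoid_itv x n y Gconn)].
have Q1 y : Q y <= 1.
  by apply: limr_le; [exact: Qcvg|near=> n; case/andP: (avoid_itv x n y Gconn)].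
(* Here time 0 counts as well. [Q] is the average of [g] over the neighbors, so [g <= Q] says that
   [g] is subharmonic. *)
pose g y := (y != x)%:R * Q y.
have gQ y : g y <= Q y by rewrite /g; case: (y != x); rewrite ?mul1r// mul0r.
have QE y : Q y = (deg G y)%:R^-1 * \sum_(z \in neighbors G y) g z.
  have [M hM] := neighbors_bounded G y.
  have QS : (avoid G x n.+1 y @[n --> \oo] --> Q y)%classic.
    by rewrite (cvg_shiftS (avoid G x ^~ y)).
  apply: (cvg_unique _ QS); first exact: norm_hausdorff.
  rewrite (sum_neighbors _ hM) /=.
  under eq_fun do rewrite (sum_neighbors _ hM).
  apply: cvgM; first exact: cvg_cst.
  apply: cvg_big => [|z _]; first exact: add_continuous.
  by apply: cvgM; [exact: cvg_cst | exact: Qcvg].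
have d0 y : 0 < (deg G y)%:R :> R by rewrite ltr0n deg_gt0.
have uC := @positive_superharmonic_const R G (fun y => 2 - g y) Gconn.
have g0 y : g y = 0.
  suff : 2 - g y = 2 - g x by rewrite {2}/g eqxx mul0r; lra.
  apply: uC => v; first by have := gQ v; have := Q1 v; lra.
  rewrite /laplacian; have [M hM] := neighbors_bounded G v.
  rewrite (sum_neighbors _ hM) (eq_bigr (fun z : 'I_M => g v - g z)); last by move=> *; lra.
  rewrite sumrB -!(sum_neighbors (fun=> g v) hM) -(sum_neighbors g hM) sum_neighbors_const.
  by rewrite subr_le0 -ler_pdivlMl// -QE.
(* The limit sought is that of returning walks, [Q x] rather than [g x]; it is an average of values
   of [g], all zero. *)
suff <- : Q x = 0 by [].
rewrite QE; have [M hM] := neighbors_bounded G x.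
by rewrite (sum_neighbors _ hM) big1 ?mulr0.
Unshelve. all: by end_near.
Qed.

(** * Almost sure return of the random walk *)

Section Recurrence.
Variables (R : realType) (G : penny_graph R) (d : measure_display)
  (T : measurableType d) (P : probability T R) (X : nat -> {RV P >-> nat}).

Local Open Scope classical_set_scope.

Lemma measurable_history (s : nat -> nat) (n : nat) : measurable (history X s n).
Proof.
have -> : history X s n = \bigcap_(k in `I_n.+1) (X k @^-1` [set s k]).
  by apply/seteqP; split=> w /= h k; [move=> /= kn; apply: h | move=> kn; apply: h].
apply: bigcap_measurable; first by exists 0%N.
by move=> k _; exact: measurable_funPTI.
Qed.

Definition avoiding (x m n : nat) : set T :=
  [set w | forall k, (m < k <= m + n)%N -> X k w != x].

Lemma measurable_avoiding (x m n : nat) : measurable (avoiding x m n).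
Proof.
have [->|n0] := posnP n.
  rewrite (_ : avoiding x m 0 = setT)//; apply/seteqP; split=> // w _ k.
  by rewrite addn0 => /andP[/leq_trans] /[apply]; rewrite ltnn.
have -> : avoiding x m n = \bigcap_(k in [set k | (m < k <= m + n)%N]) (X k @^-1` [set~ x]).
  by apply/seteqP; split=> w /= h k /= kn; apply/eqP; apply: h.
apply: bigcap_measurable; first by exists m.+1 => /=; lia.
by move=> k _; exact: measurable_funPTI.
Qed.

(** The event is split by the position [z] at time [m + 1]: the Markov property gives the factor
    [srw_step], and induction, over all histories, bounds the remaining [n] steps. *)
Lemma history_avoiding_le (x0 x : nat) (s : nat -> nat) (m n : nat) :
  graph_connected G -> simple_random_walk G X x0 ->
  (P (history X s m `&` avoiding x m n) <= P (history X s m) * (avoid G x n (s m))%:E)%E.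
Proof.
move=> Gconn [_ markov]; elim: n m s => [|n IH] m s.
  by rewrite /= mule1 le_measure ?inE//; [apply: measurableI|]; try exact: measurable_history;
    exact: measurable_avoiding.
pose s' z k := if k == m.+1 then z else s k.
have s'm z : history X (s' z) m = history X s m.
  by apply/seteqP; split=> w h k km; rewrite h// /s' ltn_eqF// ltnS.
(* Passing through [x] at time [m + 1] is excluded, which matches the factor [(z != x)%:R] in
   [avoid]. *)
pose B z := if z == x then set0 else history X (s' z) m.+1 `&` avoiding x m.+1 n.
have mB z : measurable (B z).
  rewrite /B; case: ifP => // _; apply: measurableI; first exact: measurable_history.
  exact: measurable_avoiding.
have PB z : (P (B z) <= P (history X s m) *
    (srw_step G (s m) z * ((z != x)%:R * avoid G x n z))%:E)%E.
  rewrite /B; case: eqP => /= [_|_]; first by rewrite measure0 mul0r mulr0 mule0.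
  apply: le_trans (IH _ _) _.
  rewrite markov s'm /s' eqxx ltn_eqF// mul1r EFinM muleA//.
have [M hM] := neighbors_bounded G (s m).
apply: (@le_trans _ _ (\sum_(0 <= z <oo) P (B z))%E).
  apply: measure_sigma_subadditive => //.
    apply: measurableI; first exact: measurable_history.
    exact: measurable_avoiding.
  move=> w [ws wx]; exists (X m.+1 w) => //; rewrite /B.
  rewrite (negbTE (wx m.+1 _)); last by lia.
  split=> k km; last by apply: wx; lia.
  by rewrite /s'; case: eqP => [->//|/eqP km1]; apply: ws; lia.
have c0 := measure_ge0 P (history X s m).
(* Beyond [M] there are no neighbors of [s m], so the series over all positions reduces to the
   finite sum in [avoid]. *)
rewrite (nneseries_split 0 M)// add0n (@eseries0 _ _ M) ?adde0; last first.
  move=> z Mz _; apply/eqP; rewrite -measure_le0; apply: le_trans (PB z) _.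
  rewrite /srw_step; case: ifP => [/hM|_]; first by rewrite ltnNge Mz.
  by rewrite mul0r mule0.
apply: le_trans (lee_sum _ (fun z _ => PB z)) _.
rewrite -ge0_sume_distrr; last first.
  move=> z _; rewrite lee_fin mulr_ge0//.
    by rewrite /srw_step; case: ifP => // _; rewrite invr_ge0.
  by rewrite mulr_ge0//; case/andP: (avoid_itv x n z Gconn).
rewrite sumEFin /= (sum_neighbors _ hM) big_mkord lee_wpmul2l// lee_fin.
rewrite [in leRHS]big_mkcond mulr_sumr ler_sum// => z _.
by rewrite /srw_step; case: ifP => // _; rewrite ?mul0r ?mulr0.
Qed.

(** Failing to return means avoiding [x] at the times 1 to [n] for every [n], and [avoid_cvg0] sends
    the bounds to 0. *)
Lemma return_sure (x : nat) : graph_connected G -> simple_random_walk G X x ->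
  P [set w | exists2 n, (0 < n)%N & X n w = x] = 1%E.
Proof.
move=> Gconn walk; have [start _] := walk.
set A := [set w | _].
have AE : A = \bigcup_(n in [set n | (0 < n)%N]) (X n @^-1` [set x]).
  by apply/seteqP; split=> w [n n0 nx]; exists n.
have mA : measurable A.
  by rewrite AE; apply: bigcup_measurable => k _; exact: measurable_funPTI.
have h0E : history X (fun=> x) 0 = [set w | X 0%N w = x].
  by apply/seteqP; split=> w; [apply | move=> /= ? k; rewrite leqn0 => /eqP ->].
have P0 : P (~` history X (fun=> x) 0) = 0%E.
  by rewrite probability_setC ?h0E ?start ?subee// -h0E; exact: measurable_history.
have mH := measurable_history (fun=> x) 0.
(* The walk starts at [x] only almost surely, so the null event of another start is added to the
   covering set. *)
have le_avoid n : (P (~` A) <= (avoid G x n x)%:E)%E.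
  apply: (@le_trans _ _ (P (history X (fun=> x) 0 `&` avoiding x 0 n `|`
      ~` history X (fun=> x) 0))).
    apply: le_measure; rewrite ?inE.
    - exact: measurableC.
    - apply: measurableU; last exact: measurableC.
      by apply: measurableI => //; exact: measurable_avoiding.
    - move=> w nA; have [h|] := pselect (history X (fun=> x) 0 w); last by right.
      left; split=> // k /andP[k0 _]; apply/eqP => kx; apply: nA; by exists k.
  rewrite measureU0//; last 2 first.
  - by apply: measurableI => //; exact: measurable_avoiding.
  - exact: measurableC.
  by apply: le_trans (history_avoiding_le _ _ _ _ Gconn walk) _; rewrite h0E start mul1e.
have : P (~` A) = 0%E.
  apply/eqP; rewrite -measure_le0.
  have fin : P (~` A) \is a fin_num by apply: fin_num_measure; exact: measurableC.
  rewrite -[X in (X <= _)%E]fineK// lee_fin.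
  have lim0 := avoid_cvg0 x Gconn.
  rewrite -(cvg_lim _ lim0)//; apply: limr_ge; first by apply/cvg_ex; exists 0.
  by near=> n; rewrite -lee_fin fineK.
rewrite probability_setC// => /eqP; rewrite sube_eq ?fin_num_adde_defl ?fin_num_measure//.
by rewrite add0e => /eqP <-.
Unshelve. all: by end_near.
Qed.

End Recurrence.

Theorem corollary3p6 (R : realType) (G : penny_graph R)
    (Gconn : graph_connected G) (Gdeg : bounded_facial_degree G) :
  srw_recurrent G /\
  (forall f : nat -> R,
     (forall x, 0 < f x) -> superharmonic G f -> exists a : R, forall x, f x = a).
Proof.
split=> [d T P X x|f f0 fS]; first exact: return_sure.
by exists (f 0%N) => x; exact: positive_superharmonic_const.
Qed.
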